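(* Let $G$ be any $d$-regular graph with $n$ vertices. Then, for any $\alpha>1$ there exists $C=C(\alpha)>0$ such that the cover time $T_{\mathrm{cov}}$ of the local search allocation on $G$ satisfies $$\mathbf{Pr}\left[\,T_{\mathrm{cov}}\ge C\cdot\left(n\Big(1+\frac{\log n\cdot\log d}{d}\Big)\right)\right]\le n^{-\alpha}.$$
   Context: Graphs are undirected, not necessarily connected; $\log$ is the natural logarithm. Local search allocation on $G=(V,E)$: initially all vertices have load $0$. Balls $1,2,\dots$ arrive one at a time. Ball $i$ is born at a vertex $U_i$ (its birthplace) chosen independently and uniformly at random from $V$. Starting at its birthplace, in each step the ball moves to a neighbour of its current vertex having the smallest load among all neighbours, provided that this load is strictly smaller than the load of the current vertex; ties between smallest-load neighbours are broken independently and uniformly at random. The ball stops at the first vertex visited that has no neighbour of strictly smaller load, and it is allocated there, increasing that vertex's load by $1$. Then the next ball arrives. $X_v^{(m)}$ denotes the load of $v$ after $m$ balls have been allocated. The cover time is $T_{\mathrm{cov}}=\min\{m\ge 0: X_v^{(m)}\ge 1\text{ for all }v\in V\}$.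
   Formalization: The formal theorem assumes d ≥ 2: for d = 0 the bound contains log 0 / 0 and is undefined, and for d = 1 the claim fails on perfect matchings, where the bound is C·n but the cover time is at least about (n/2) log n with high probability. *)

(* Defs.v *)
From HB Require Import structures.
From mathcomp Require Import all_boot all_order all_algebra.
From mathcomp Require Import all_classical all_reals all_analysis.
Set Implicit Arguments.
Unset Strict Implicit.
Unset Printing Implicit Defensive.
Import Order.TTheory GRing.Theory Num.Theory.
Local Open Scope classical_set_scope.
Local Open Scope ring_scope.

(* A simple graph on V is a symmetric irreflexive relation e : rel V. *)
Definition regular_graph (V : finType) (e : rel V) (d : nat) : Prop :=
  forall v : V, #|[set w | e v w]%SET| = d.

(* The trajectory of a ball is (u, s): u is its birthplace and s lists the
   vertices it moves to, in order; the ball is allocated to last u s. *)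
Definition trajectory (V : finType) : Type := (V * seq V)%type.

Definition allocated_at (V : finType) (q : trajectory V) : V := last q.1 q.2.

Definition load (V : finType) (h : seq (trajectory V)) (v : V) : nat :=
  count (fun q => allocated_at q == v) h.

Definition min_neighbours (V : finType) (e : rel V) (x : V -> nat) (u : V)
    : {set V} :=
  [set v | e u v && [forall w, e u w ==> (x v <= x w)%N]]%SET.

Definition is_local_min (V : finType) (e : rel V) (x : V -> nat) (u : V)
    : bool :=
  ~~ [exists v, e u v && (x v < x u)%N].

(* Probability that, under loads x, a ball currently at u makes exactly the
   moves s and then stops. *)
Fixpoint moves_prob (R : realType) (V : finType) (e : rel V) (x : V -> nat)
    (u : V) (s : seq V) : R :=
  match s with
  | [::] => if is_local_min e x u then 1 else 0
  | v :: s' =>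
      if (v \in min_neighbours e x u) && (x v < x u)%N
      then #|min_neighbours e x u|%:R^-1 * moves_prob R e x v s'
      else 0
  end.

Definition trajectory_prob (R : realType) (V : finType) (e : rel V)
    (x : V -> nat) (q : trajectory V) : R :=
  #|V|%:R^-1 * moves_prob R e x q.1 q.2.

Section Process.
Variables (R : realType) (disp : measure_display) (T : measurableType disp).
Variables (V : finType) (ball : nat -> T -> trajectory V).

(* Balls are numbered from 0, so these are the first m balls. *)
Definition history (m : nat) (w : T) : seq (trajectory V) :=
  mkseq (fun i => ball i w) m.

Definition loads_after (m : nat) (w : T) : V -> nat := load (history m w).

(* Takes the value +oo if some vertex remains empty forever. *)
Definition cover_time (w : T) : \bar R :=
  ereal_inf [set (m%:R)%:E |
    m in [set m : nat | forall v : V, (1 <= loads_after m w v)%N]].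

End Process.

(* Given the trajectories h of the first m balls, the next ball has trajectory
   q with conditional probability trajectory_prob R e (load h) q.  This is the
   joint law of all birthplaces and moves: conditionally on everything before
   it, each birthplace is uniform on V and each move is uniform on the
   neighbours of smallest load. *)
Record local_search_allocation (R : realType) (disp : measure_display)
    (T : measurableType disp) (P : probability T R) (V : finType) (e : rel V)
    (ball : nat -> T -> trajectory V) : Prop := {
  measurable_ball : forall (i : nat) (q : trajectory V),
    measurable [set w | ball i w = q];
  ball_law : forall (m : nat) (h : seq (trajectory V)) (q : trajectory V),
    P [set w | history ball m.+1 w = rcons h q] =
    (P [set w | history ball m w = h] * (trajectory_prob R e (load h) q)%:E)%E
}.

(* Main.v *)
(* Let Z_w be the number of uncovered neighbours of w.  A ball born on an
   uncovered vertex u covers it, and a ball born on a covered neighbour w of u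
   covers u with probability 1/Z_w.  If Z_w <= z for all w, then u has at least
   d - z covered neighbours and is covered in each step with probability at
   least (1/n) (1 + (d - z)/z) = d/(zn).  For a set S of more than z/2 uncovered
   vertices these events are disjoint, so S survives t steps with probability
   at most (1 - d/(2n))^t.  A union bound over w and the at most 2^z subsets S
   of its uncovered neighbours shows that O((n/d) (z + log n)) steps halve the
   bound z with high probability.  Starting from z = d this is done about log d
   times; the terms z sum up to O(d) and the terms log n to O(log n log d). *)
Require Import Defs.
From HB Require Import structures.
From mathcomp Require Import all_boot all_order all_algebra.
From mathcomp Require Import all_classical all_reals all_analysis.
From mathcomp Require Import ring lra zify.
Import Order.TTheory GRing.Theory Num.Theory.
Local Open Scope classical_set_scope.
Local Open Scope ring_scope.

(** * Random variables with countably many values: sums over fibres *)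

Section CountablePartition.
Context {R : realType} {disp : measure_display} {T : measurableType disp}.
Context {C : countType} (X : T -> C).
Hypothesis mX : forall c, measurable (X @^-1` [set c]).

Lemma measurable_countable_preimage (A : set C) : measurable (X @^-1` A).
Proof.
have -> : X @^-1` A = \bigcup_c (if c \in A then X @^-1` [set c] else set0).
  apply/seteqP; split=> w /=.
    by move=> AXw; exists (X w) => //; rewrite mem_set.
  by move=> [c _]; case: ifPn => // /set_mem Ac /= ->.
apply: countable_bigcupT_measurable; first exact: countableP.
by move=> c; case: ifP.
Qed.

(** Plays the role of conditioning on [X]: a ratio that holds on every fibre survives summation over
    the countably many fibres. *)
Lemma measure_le_fibres (P : {measure set T -> \bar R}) (A B : set T) (c : R) :
  measurable A -> measurable B ->
  (forall x, (P (A `&` X @^-1` [set x]) <= c%:E * P (B `&` X @^-1` [set x]))%E) ->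
  (P A <= c%:E * P B)%E.
Proof.
move=> mA mB le_fibre.
(* Fibres are numbered by the codes of [C]; a number that codes no value gives the empty set. *)
pose F k := X @^-1` [set x | pickle x = k].
have mF k : measurable (F k) by exact: measurable_countable_preimage.
have sumF D : measurable D -> P D = (\sum_(k <oo) P (D `&` F k))%E.
  move=> mD; rewrite -[in LHS](setIT D).
  have -> : [set: T] = \bigcup_k F k.
    by apply/seteqP; split=> // w _; exists (pickle (X w)).
  rewrite setI_bigcupr measure_semi_bigcup //.
  - by move=> k; exact: measurableI.
  - by move=> i j _ _ [w [[_ <-] [_ <-]]].
  - by apply: bigcup_measurable => k _; exact: measurableI.
rewrite (sumF A) // (sumF B) // -nneseriesZl //; apply: lee_nneseries => // k _.
case Dk: (@pickle_inv C k) => [x|].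
  have -> : F k = X @^-1` [set x].
    apply/seteqP; split=> w; rewrite /F /=.
      by move=> kX; move: Dk; rewrite -kX pickleK_inv => -[].
    by move=> ->; move: (@pickle_invK C k); rewrite /ocancel Dk.
  exact: le_fibre.
have -> : F k = set0.
  by apply/seteqP; split=> w //; rewrite /F /= => kX; move: Dk; rewrite -kX pickleK_inv.
by rewrite !setI0 measure0 mule0.
Qed.

(** Splits off one value at a time, so the probability of a miss follows from the law of the listed
    values alone. *)
Lemma measure_notin_seq (P : {measure set T -> \bar R}) (E : set T) (s : seq C) :
  measurable E -> uniq s ->
  P E = (P (E `&` [set w | X w \notin s]) +
         \sum_(x <- s) P (E `&` X @^-1` [set x]))%E.
Proof.
move=> mE; elim: s => [|x s IH] /=.
  by move=> _; rewrite big_nil adde0; congr (P _); apply/seteqP; split=> // w [].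
move=> /andP[xs us]; rewrite big_cons addeA (IH us); congr (_ + _)%E.
have mN (s' : seq C) : measurable (E `&` [set w | X w \notin s']).
  by apply: measurableI => //;
    exact: (measurable_countable_preimage [set x | x \notin s']).
rewrite -measureU //; last 2 first.
- exact: measurableI.
- apply/seteqP; split=> w // [[_ /= +] [_ /= Xw]].
  by rewrite Xw mem_head.
congr (P _); apply/seteqP; split=> w /=.
  move=> [Ew nXw]; have [Xw|Xw] := eqVneq (X w) x; first by right.
  by left; rewrite inE negb_or Xw nXw.
move=> [[Ew]|[Ew ->]]; last by split.
by rewrite inE negb_or => /andP[_].
Qed.

End CountablePartition.

(** * One allocation step: hitting uncovered vertices *)

Section OneStep.
Context {V : finType} (e : rel V).
Implicit Types (h : seq (trajectory V)) (q : trajectory V) (u v w : V).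
Implicit Types S : {set V}.

Definition uncovered h : {set V} := [set v | load h v == 0]%SET.

Definition uncovered_nbrs h w : {set V} := [set v in uncovered h | e w v]%SET.

Definition sparse (z : nat) h := [forall w, (#|uncovered_nbrs h w| <= z)%N].

Lemma load_rcons h q v : load (rcons h q) v = (load h v + (allocated_at q == v))%N.
Proof. by rewrite /load -cats1 count_cat /= addn0. Qed.

Lemma uncovered_rcons h q : uncovered (rcons h q) \subset uncovered h.
Proof.
by apply/fintype.subsetP => v; rewrite !inE load_rcons addn_eq0 => /andP[].
Qed.

(* Trajectories of at most one step which cover a vertex of S; a ball born on
   a covered neighbour w of an uncovered vertex moves to a uniformly chosen
   uncovered neighbour of w and stops there. *)
Definition hits h S : seq (trajectory V) :=
  [seq (u, [::]) | u <- enum S] ++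
  [seq (w, [:: u]) |
    u <- enum S, w <- enum [set w | e u w && (w \notin uncovered h)]%SET].

Lemma hits_uniq h S : uniq (hits h S).
Proof.
rewrite cat_uniq map_inj_uniq ?enum_uniq /=; last by move=> u v [].
apply/andP; split.
  by apply/hasPn => _ /allpairsPdep[u [w [_ _ ->]]]; apply/mapP => -[].
apply: allpairs_uniq_dep => [||[u w] [u' w'] _ _ /= [-> ->]] //.
- exact: enum_uniq.
- by move=> u _; exact: enum_uniq.
Qed.

Lemma allocated_at_hits h S q : q \in hits h S -> allocated_at q \in S.
Proof.
rewrite mem_cat => /orP[/mapP[u + ->]|/allpairsPdep[u [w [+ _ ->]]]];
  by rewrite mem_enum.
Qed.

Lemma uncovered_local_min h u : u \in uncovered h -> is_local_min e (load h) u.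
Proof.
rewrite inE => /eqP hu; rewrite /is_local_min hu.
by apply/existsPn => v; rewrite ltn0 andbF.
Qed.

(** An uncovered neighbour has load 0, the least possible, so exactly the uncovered neighbours
    attain the minimum. *)
Lemma min_neighbours_uncovered h u w : u \in uncovered_nbrs h w ->
  min_neighbours e (load h) w = uncovered_nbrs h w.
Proof.
rewrite !inE => /andP[/eqP hu ewu]; apply/setP => v; rewrite !inE andbC.
case ewv: (e w v); rewrite ?andbF // !andbT; apply/forallP/eqP => [/(_ u)|hv v'].
  by rewrite ewu hu leqn0 => /eqP.
by rewrite hv implybT.
Qed.

Variable R : realType.

Lemma trajectory_prob_stay h u : u \in uncovered h ->
  trajectory_prob R e (load h) (u, [::]) = #|V|%:R^-1.
Proof.
by move=> hu; rewrite /trajectory_prob /= uncovered_local_min // mulr1.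
Qed.

Lemma trajectory_prob_move h u w : u \in uncovered_nbrs h w -> w \notin uncovered h ->
  trajectory_prob R e (load h) (w, [:: u]) =
  #|V|%:R^-1 * #|uncovered_nbrs h w|%:R^-1.
Proof.
move=> hu hw; rewrite /trajectory_prob /= (min_neighbours_uncovered _ _ _ hu) hu.
move: hu; rewrite inE => /andP[hu _]; rewrite uncovered_local_min // mulr1.
by move: hu hw; rewrite !inE -lt0n => /eqP -> ->.
Qed.

(* Each u in S is hit with probability at least
   (1/n) (1 + sum of 1/#|uncovered_nbrs h w| over the covered neighbours w of u),
   hence at least (1/n) (1 + (d - z)/z). *)
Lemma sum_hits_ge (d z : nat) h S : symmetric e -> regular_graph e d -> (0 < z)%N ->
  sparse z h -> S \subset uncovered h ->
  #|S|%:R * d%:R / (z%:R * #|V|%:R) <=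
  \sum_(q <- hits h S) trajectory_prob R e (load h) q :> R.
Proof.
move=> esym ereg z0 hz /fintype.subsetP SU.
rewrite big_cat big_map big_allpairs_dep /= big_enum /= big_enum /= -big_split /=.
have -> : #|S|%:R * d%:R / (z%:R * #|V|%:R) =
    \sum_(u in S) (#|V|%:R^-1 * (d%:R / z%:R)) :> R.
  by rewrite sumr_const -mulr_natl invfM; ring.
apply: ler_sum => u uS; rewrite trajectory_prob_stay ?SU // big_enum /=.
have zR : 0 < z%:R :> R by rewrite ltr0n.
set N := [set w | e u w && (w \notin uncovered h)]%SET.
apply: (@le_trans _ _ (#|V|%:R^-1 + \sum_(w in N) (#|V|%:R^-1 * z%:R^-1))); last first.
  rewrite lerD2l; apply: ler_sum => w; rewrite inE => /andP[euw hw].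
  have uw : u \in uncovered_nbrs h w by rewrite inE SU //= esym.
  rewrite trajectory_prob_move // ler_wpM2l // lef_pV2 ?posrE ?ltr0n //.
    by rewrite ler_nat; exact: (forallP hz).
  by apply/card_gt0P; exists u.
rewrite sumr_const -[X in _ <= X + _]mulr1 -mulrnAr -mulrDr ler_wpM2l //.
rewrite ler_pdivrMr // -[_ *+ #|N|]mulr_natl mulrDl mul1r -mulrA mulVf ?mulr1 ?gt_eqF //.
(* The [d] neighbours of [u] are the uncovered ones, at most [z] by sparsity at [u], and the covered
   ones in [N]. *)
rewrite -natrD ler_nat -(ereg u) -(cardsID (uncovered h) [set w | e u w]%SET).
apply: leq_add; last by apply/subset_leq_card/fintype.subsetP => w; rewrite !inE andbC.
apply: leq_trans (forallP hz u); apply/subset_leq_card/fintype.subsetP => w.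
by rewrite !inE andbC.
Qed.

End OneStep.

(** * Union bound and elementary size bounds *)

Lemma measure_le_size {R : realType} {disp : measure_display}
    {T : measurableType disp} (P : {measure set T -> \bar R}) (I : eqType)
    (s : seq I) (F : I -> set T) (A : set T) (c : R) :
  measurable A -> (forall i, measurable (F i)) ->
  (forall w, A w -> exists2 i, i \in s & F i w) ->
  (forall i, i \in s -> (P (F i) <= c%:E)%E) ->
  (P A <= ((size s)%:R * c)%:E)%E.
Proof.
move=> + mF; elim: s A => [|i s IH] A mA AF le_c.
  have -> : A = set0 by apply/seteqP; split=> // w /AF[].
  by rewrite measure0 mul0r.
have mD : measurable (A `\` F i) by exact: measurableD.
apply: (@le_trans _ _ (P (F i `|` (A `\` F i)))).
  apply: le_measure; rewrite ?inE //; first exact: measurableU.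
  by move=> w Aw; have [|] := pselect (F i w); [left|right].
apply: (le_trans (measureU2 _ (mF i) mD)).
rewrite /= -natr1 mulrDl mul1r addrC EFinD leeD ?le_c ?mem_head //.
apply: IH => // [w [/AF[j + Fj] nFi]|j js]; last by rewrite le_c // inE js orbT.
by rewrite inE => /orP[/eqP ji|]; [rewrite ji in Fj | exists j].
Qed.

(** Excludes [n = 0]: the whole space has measure 1, hence is nonempty. *)
Lemma card_codomain_gt0 {R : realType} {disp : measure_display}
    {T : measurableType disp} (P : probability T R) {V : finType} (X : T -> V) :
  (0 < #|V|)%N.
Proof.
have [V0|//] := posnP #|V|; have : P setT = 0%E.
  rewrite (_ : setT = set0) ?measure0 //; apply/seteqP; split=> // w _.
  by have := card0_eq V0 (X w); rewrite inE.
by rewrite probability_setT => /eqP; rewrite onee_eq0.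
Qed.

Lemma regular_degree_le_card {V : finType} {e : rel V} {d : nat} :
  regular_graph e d -> (0 < #|V|)%N -> (d <= #|V|)%N.
Proof. by move=> ereg /card_gt0P[v _]; rewrite -(ereg v) max_card. Qed.

(** * Law and measurability of the history *)

Section Allocation.
Context {R : realType} {disp : measure_display} {T : measurableType disp}.
Context {P : probability T R} {V : finType} {e : rel V}.
Context {ball : nat -> T -> trajectory V}.
Hypothesis alloc : local_search_allocation P e ball.

Notation hist := (history ball).
Local Arguments history : simpl never.

Lemma historyS m w : hist m.+1 w = rcons (hist m w) (ball m w).
Proof. exact: mkseqS. Qed.

Lemma measurable_history_eq m h : measurable [set w | hist m w = h].
Proof.
elim: m h => [|m IH] h.
  have [->|/eqP hn] := eqVneq h [::].
    by rewrite (_ : [set _ | _] = setT) //; apply/seteqP.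
  by rewrite (_ : [set _ | _] = set0) //; apply/seteqP; split=> w //= /esym.
case/lastP: h => [|h q].
  by rewrite (_ : [set _ | _] = set0) //; apply/seteqP; split=> w //=.
rewrite (_ : [set _ | _] = [set w | hist m w = h] `&` [set w | ball m w = q]).
  by apply: measurableI => //; exact: measurable_ball alloc _ _.
apply/seteqP; split=> w /=; rewrite historyS; last by move=> [-> ->].
by move=> /rcons_inj[].
Qed.

Lemma measurable_history m (A : set (seq (trajectory V))) :
  measurable [set w | A (hist m w)].
Proof. exact: (measurable_countable_preimage _ (measurable_history_eq m) A). Qed.

Lemma uncovered_history m t w : uncovered (hist (m + t) w) \subset uncovered (hist m w).
Proof.
elim: t => [|t IH]; first by rewrite addn0.
by rewrite addnS historyS; exact: fintype.subset_trans (uncovered_rcons _ _) IH.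
Qed.

Lemma sparse_history z m t w : sparse e z (hist m w) -> sparse e z (hist (m + t) w).
Proof.
move=> /forallP hz; apply/forallP => v; apply: leq_trans (hz v).
apply/subset_leq_card/fintype.subsetP => u; rewrite !inE => /andP[+ ->].
move=> /[!andbT] hu; have /fintype.subsetP/(_ u) := uncovered_history m t w.
by rewrite !inE; apply.
Qed.

(** By [ball_law], the trajectories in [s] take up at least a fraction [delta] of the event that the
    history is [h]; a miss has only the rest. *)
Lemma next_ball_miss m h (s : seq (trajectory V)) (delta : R) :
  uniq s -> delta <= \sum_(q <- s) trajectory_prob R e (load h) q ->
  (P ([set w | hist m w = h] `&` [set w | ball m w \notin s]) <=
   (1 - delta)%:E * P [set w | hist m w = h])%E.
Proof.
move=> us le_delta; set E := [set w | hist m w = h].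
have mE : measurable E by exact: measurable_history_eq.
have : P E = (P (E `&` [set w | ball m w \notin s]) +
    \sum_(q <- s) P E * (trajectory_prob R e (load h) q)%:E)%E.
  rewrite [LHS](measure_notin_seq _ (measurable_ball alloc m) P _ _ mE us).
  congr (_ + _)%E; apply: eq_bigr => q _; rewrite -(ball_law alloc); congr (P _).
  apply/seteqP; split=> w /=; rewrite historyS; first by move=> [-> ->].
  by move=> /rcons_inj[].
have fE : P E \is a fin_num by exact: fin_num_measure.
have fN : P (E `&` [set w | ball m w \notin s]) \is a fin_num.
  apply: fin_num_measure; apply: measurableI => //.
  exact: (measurable_countable_preimage _ (measurable_ball alloc m) [set q | q \notin s]).
have p0 : 0 <= fine (P E) by apply: fine_ge0.
rewrite -(fineK fE) -(fineK fN).
under eq_bigr do rewrite -EFinM.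
rewrite sumEFin -EFinD -EFinM lee_fin -mulr_sumr => -[eq_p].
have := ler_wpM2l p0 le_delta.
lra.
Qed.

(** * Survival of a fixed set of uncovered vertices *)

Section Survival.
Context {d : nat} (esym : symmetric e) (ereg : regular_graph e d).
Variables (z : nat) (z_gt0 : (0 < z)%N).

(** Conditions on the history after [m] balls. [A] is an arbitrary property implying sparsity, so
    that [survive] can also keep the initial history fixed along its induction. *)
Lemma survive_step m (S : {set V}) (A : set (seq (trajectory V))) :
  (forall h, A h -> sparse e z h) ->
  (P [set w | A (hist m w) /\ S \subset uncovered (hist m.+1 w)] <=
   (1 - #|S|%:R * d%:R / (z%:R * #|V|%:R))%:E *
     P [set w | A (hist m w) /\ S \subset uncovered (hist m w)])%E.
Proof.
move=> Asparse; set A' := [set h | A h /\ S \subset uncovered h].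
apply: (measure_le_fibres _ (measurable_history_eq m)) => [||h].
- apply: measurableI; first exact: measurable_history.
  exact: (measurable_history m.+1 [set h | S \subset uncovered h]).
- exact: (measurable_history m A').
have [[Ah Sh]|nA] := pselect (A' h); last first.
  rewrite (_ : _ `&` _ = set0) ?measure0; last first.
    apply/seteqP; split=> w //= [[Aw Sw] hw]; apply: nA; rewrite /A' /= -hw; split=> //.
    by apply: fintype.subset_trans Sw _; rewrite historyS; exact: uncovered_rcons.
  rewrite (_ : _ `&` _ = set0) ?measure0 ?mule0 //.
  by apply/seteqP; split=> w //= [Aw hw]; apply: nA; rewrite -hw.
have := next_ball_miss m h _ _ (hits_uniq e h S)
  (sum_hits_ge e R d z h S esym ereg z_gt0 (Asparse _ Ah) Sh).
have -> : [set w | A (hist m w) /\ S \subset uncovered (hist m w)]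
    `&` hist m @^-1` [set h] = [set w | hist m w = h].
  by apply/seteqP; split=> w /= => [[]|hw] //; rewrite hw.
apply: le_trans; apply: le_measure; rewrite ?inE.
- apply: measurableI; last exact: measurable_history_eq.
  apply: measurableI; first exact: measurable_history.
  exact: (measurable_history m.+1 [set h | S \subset uncovered h]).
- apply: measurableI; first exact: measurable_history_eq.
  exact: (measurable_countable_preimage _ (measurable_ball alloc m)
    [set q | q \notin hits e h S]).
(* If ball [m] were a hit, the vertex of [S] where it stops would be covered. *)
move=> w [[_ Sw] /= hw]; split => //=; apply/negP => /allocated_at_hits qS.
move/fintype.subsetP: Sw => /(_ _ qS).
by rewrite inE historyS load_rcons eqxx addn1.
Qed.

Lemma survive m t h (S : {set V}) (delta : R) :
  sparse e z h -> delta <= 1 -> delta <= #|S|%:R * d%:R / (z%:R * #|V|%:R) ->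
  (P [set w | hist m w = h /\ S \subset uncovered (hist (m + t) w)] <=
   ((1 - delta) ^+ t)%:E * P [set w | hist m w = h])%E.
Proof.
move=> hz delta1 le_delta; elim: t => [|t IH].
  rewrite addn0 expr0 mul1e; apply: le_measure; rewrite ?inE.
  - apply: measurableI; first exact: measurable_history_eq.
    exact: (measurable_history m [set h | S \subset uncovered h]).
  - exact: measurable_history_eq.
  - by move=> w [].
have mhist w k : take m (hist (m + k) w) = hist m w.
  by rewrite /history /mkseq -map_take take_iota (minn_idPl (leq_addr _ _)).
(* The initial history is a prefix of every later one, so fixing it is a property of the later
   history, as [survive_step] demands. *)
pose A := [set h' | take m h' = h /\ sparse e z h'].
have toA k : [set w | hist m w = h /\ S \subset uncovered (hist k w)] =
    [set w | A (hist (m + t) w) /\ S \subset uncovered (hist k w)].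
  apply/seteqP; split=> w /=; rewrite /A /= mhist; last by move=> [[]].
  by move=> [hw Sw]; do 2?split=> //; apply: sparse_history; rewrite hw.
rewrite addnS toA; apply: (le_trans (survive_step _ _ _ _)); first by move=> h' [].
rewrite -toA exprS EFinM -muleA.
apply: (@le_trans _ _ ((1 - delta)%:E *
    P [set w | hist m w = h /\ S \subset uncovered (hist (m + t) w)])%E).
  by apply: lee_wpmul2r => //; rewrite lee_fin lerB.
by apply: lee_wpmul2l => //; rewrite lee_fin subr_ge0.
Qed.

End Survival.

(** * Halving the number of uncovered neighbours *)

Section Cover.
Context {d : nat} (esym : symmetric e) (ereg : regular_graph e d) (d_gt0 : (0 < d)%N).

Lemma sparse_degree h : sparse e d h.
Proof.
apply/forallP => w; rewrite -(ereg w); apply/subset_leq_card/fintype.subsetP => v.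
by rewrite !inE => /andP[].
Qed.

(** As [d > 0], an uncovered [v] would by symmetry be an uncovered neighbour of some [w]. *)
Lemma sparse0_covered h v : sparse e 0 h -> (0 < load h v)%N.
Proof.
move=> /forallP h0; rewrite lt0n; apply/negP => hv.
have /card_gt0P[w] : (0 < #|[set w | e v w]%SET|)%N by rewrite ereg.
rewrite inE => evw; have := h0 w; rewrite leqn0 cards_eq0 => /eqP/setP/(_ v).
by rewrite !inE hv esym evw.
Qed.

(** Failure event of a stage of [t] balls; the start [m] is free so that consecutive stages can be
    chained. *)
Definition stuck z z' m t : set T :=
  [set w | sparse e z (hist m w) /\ ~~ sparse e z' (hist (m + t) w)].

Lemma measurable_stuck z z' m t : measurable (stuck z z' m t).
Proof.
apply: measurableI; first exact: (measurable_history m (sparse e z)).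
exact: (measurable_history (m + t) [set h | ~~ sparse e z' h]).
Qed.

(* A witness of failure is a set of more than z/2 of the at most z uncovered
   neighbours of some vertex; there are at most n 2^z such sets, and one of
   them is hit with probability at least d/(2n) in each step. *)
Lemma stuck_half z m t : (0 < z)%N ->
  (P (stuck z z./2 m t) <=
   (#|V|%:R * (2 ^+ z * (1 - d%:R / (2 * #|V|%:R)) ^+ t))%:E)%E.
Proof.
move=> z_gt0; set c := (1 - _) ^+ t.
have n_gt0 := card_codomain_gt0 P (fun w => (ball 0 w).1).
have nR : 0 < #|V|%:R :> R by rewrite ltr0n.
have delta1 : d%:R / (2 * #|V|%:R) <= 1 :> R.
  rewrite ler_pdivrMr ?mulr_gt0 // mul1r.
  have : d%:R <= #|V|%:R :> R by rewrite ler_nat (regular_degree_le_card ereg n_gt0).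
  lra.
have c0 : 0 <= c by rewrite exprn_ge0 // subr_ge0.
suff : (P (stuck z z./2 m t) <= (#|V|%:R * (2 ^+ z * c))%:E * P setT)%E.
  by rewrite probability_setT mule1.
apply: (measure_le_fibres _ (measurable_history_eq m)) => // [|h].
  exact: measurable_stuck.
rewrite setTI -[X in (_ <= _ * X)%E]fineK ?fin_num_measure //; last first.
  exact: measurable_history_eq.
set p := fine _; have p0 : 0 <= p by exact: fine_ge0.
rewrite -EFinM -!mulrA.
have [hz|nhz] := boolP (sparse e z h); last first.
  rewrite (_ : _ `&` _ = set0) ?measure0 ?lee_fin ?mulr_ge0 ?exprn_ge0 ?subr_ge0 //.
  by apply/seteqP; split=> w //= [[+ _] hw]; rewrite hw (negbTE nhz).
have mstay (S : {set V}) :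
    measurable [set w | hist m w = h /\ S \subset uncovered (hist (m + t) w)].
  apply: measurableI; first exact: measurable_history_eq.
  exact: (measurable_history _ [set h | S \subset uncovered h]).
pose F v := [set w | hist m w = h /\
  (z./2 < #|uncovered_nbrs e (hist (m + t) w) v|)%N].
have mF v : measurable (F v).
  apply: measurableI; first exact: measurable_history_eq.
  exact: (measurable_history _ [set h | (z./2 < #|uncovered_nbrs e h v|)%N]).
rewrite [in X in (_ <= X)%E]cardE; apply: (measure_le_size _ _ _ F) => //.
- by apply: measurableI; [exact: measurable_stuck|exact: measurable_history_eq].
- move=> w [[_ /forallPn[v]]]; rewrite -ltnNge => hv hw.
  by exists v; rewrite ?mem_enum.
move=> v _.
(* Candidate sets lie inside the uncovered neighbours at time [m], which [h] fixes, so there are at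
   most [2 ^ z]; by monotonicity those left at time [m + t] form one of them. *)
pose D := [set S in powerset (uncovered_nbrs e h v) | (z./2 < #|S|)%N]%SET.
have : (P (F v) <= ((size (enum D))%:R * (c * p))%:E)%E.
  apply: (measure_le_size _ _ _ _ _ _ (mF v) mstay) => [w [hw hv]|S].
    exists (uncovered_nbrs e (hist (m + t) w) v).
      rewrite mem_enum !inE hv andbT -hw; apply/fintype.subsetP => u; rewrite !inE.
      move=> /andP[hu ->]; have /fintype.subsetP/(_ u) := uncovered_history m t w.
      by rewrite !inE hu => ->.
    by split=> //; apply/fintype.subsetP => u; rewrite inE => /andP[].
  rewrite mem_enum !inE => /andP[_ zS].
  rewrite EFinM /p fineK ?fin_num_measure //; last exact: measurable_history_eq.
  apply: (survive esym ereg z z_gt0 m t h S _ hz delta1).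
  (* More than [z./2] vertices means [z <= 2 * #|S|], so the hit rate is at least [d / (2n)]. *)
  rewrite invfM mulrA invfM mulrA ler_pM2r ?invr_gt0 // mulrAC.
  rewrite mulrC ler_wpM2r // ler_pdivlMr ?ltr0n // ler_pdivrMl // -natrM ler_nat.
  lia.
move/le_trans; apply; rewrite lee_fin ler_wpM2r ?mulr_ge0 //.
rewrite -natrX ler_nat -cardE; apply: (@leq_trans #|powerset (uncovered_nbrs e h v)|).
  by apply/subset_leq_card/fintype.subsetP => S; rewrite inE => /andP[].
by rewrite card_powerset leq_exp2l //; exact: (forallP hz).
Qed.

Variable b : R.
Hypothesis b_ge0 : 0 <= b.
Let n := #|V|.
Let L : R := ln n%:R.

(** With [y = d / (2n)], [1 - y <= exp(-y)] and [t] just large enough that [y * t >= z ln 2 + b L],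
    the first term cancels [2 ^ z] and the second leaves [n ^ (-b)]. *)
Lemma stuck_half_whp z : (0 < z)%N -> exists2 t : nat,
  t%:R <= 2 * n%:R / d%:R * (z%:R * ln 2 + b * L) + 1 :> R &
  forall m, (P (stuck z z./2 m t) <= (n%:R * expR (- (b * L)))%:E)%E.
Proof.
move=> z_gt0; set x := _ * _.
have dR : 0 < d%:R :> R by rewrite ltr0n.
have n_gt0 : (0 < n)%N := card_codomain_gt0 P (fun w => (ball 0 w).1).
have nR : 0 < n%:R :> R by rewrite ltr0n.
have L0 : 0 <= L by rewrite ln_ge0 // ler1n.
have x0 : 0 <= x.
  by rewrite mulr_ge0 ?divr_ge0 ?mulr_ge0 // addr_ge0 ?mulr_ge0 // ln_ge0 // ler1n.
exists (Num.truncn x).+1.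
  by rewrite -natr1 lerD2r; have /andP[] := truncn_itv x0.
move=> m; apply: (le_trans (stuck_half z m _ z_gt0)); rewrite lee_fin ler_wpM2l //.
set t := (Num.truncn x).+1; have xt : x < t%:R by exact: truncnS_gt.
set y := d%:R / _.
have y1 : 0 <= 1 - y.
  rewrite subr_ge0 ler_pdivrMr ?mulr_gt0 // mul1r.
  have : d%:R <= n%:R :> R by rewrite ler_nat (regular_degree_le_card ereg n_gt0).
  lra.
have -> : 2 ^+ z = expR (z%:R * ln 2) :> R by rewrite expRM_natl lnK ?posrE.
apply: (@le_trans _ _ (expR (z%:R * ln 2) * expR (t%:R * - y))).
  by rewrite ler_wpM2l ?expR_ge0 // expRM_natl lerXn2r ?nnegrE ?expR_ge0 // expR_ge1Dx.
rewrite -expRD ler_expR.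
have yx : y * x = z%:R * ln 2 + b * L.
  by rewrite /y /x -/n; field; rewrite !gt_eqF.
have : y * x <= y * t%:R.
  by rewrite ler_wpM2l ?(ltW xt) // divr_ge0 // mulr_ge0.
rewrite yx; lra.
Qed.

(* Halving the bound z repeatedly, the terms z ln 2 sum up geometrically while
   b ln n is paid once for each of the J stages. *)
Lemma covered_whp J z : (z < 2 ^ J)%N -> exists2 M : nat,
  M%:R <= 2 * n%:R / d%:R * (2 * z%:R * ln 2 + J%:R * (b * L)) + J%:R :> R &
  forall m, (P (stuck z 0 m M) <= (J%:R * (n%:R * expR (- (b * L))))%:E)%E.
Proof.
have dR : 0 < d%:R :> R by rewrite ltr0n.
have n_gt0 : (0 < n)%N := card_codomain_gt0 P (fun w => (ball 0 w).1).
have nR : 0 < n%:R :> R by rewrite ltr0n.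
have L0 : 0 <= L by rewrite ln_ge0 // ler1n.
have ln20 : 0 <= ln 2 :> R by rewrite ln_ge0 // ler1n.
have a0 : 0 <= 2 * n%:R / d%:R :> R by rewrite divr_ge0 // mulr_ge0.
have bL0 : 0 <= b * L by rewrite mulr_ge0.
elim: J z => [|J IH] z zJ; have [z0|z_gt0] := posnP z.
- exists 0%N => [|m]; first by rewrite addr_ge0 // mulr_ge0 // addr_ge0 // !mulr_ge0.
  rewrite (_ : stuck _ _ _ _ = set0) ?measure0 ?mul0r //.
  by apply/seteqP; split=> w //; rewrite /stuck /= z0 addn0 => -[->].
- by move: zJ; rewrite expn0 ltnS leqNgt z_gt0.
- exists 0%N => [|m]; first by rewrite addr_ge0 // mulr_ge0 // addr_ge0 // !mulr_ge0.
  rewrite (_ : stuck _ _ _ _ = set0) ?measure0 ?lee_fin ?mulr_ge0 ?expR_ge0 //.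
  by apply/seteqP; split=> w //; rewrite /stuck /= z0 addn0 => -[->].
have [t t_le tP] := stuck_half_whp z z_gt0.
have [|M M_le MP] := IH z./2; first by move: zJ; rewrite expnS; lia.
exists (t + M)%N => [|m].
  rewrite natrD; apply: (le_trans (lerD t_le M_le)).
  (* Rounding down makes the [ln 2] terms sum geometrically: [z + 2 * z./2 <= 2 * z]. *)
  have z2 : 2 * (z./2)%:R <= z%:R :> R by rewrite -natrM ler_nat; lia.
  have : 2 * n%:R / d%:R * (2 * (z./2)%:R * ln 2) <= 2 * n%:R / d%:R * (z%:R * ln 2) :> R.
    by rewrite ler_wpM2l // ler_wpM2r.
  by rewrite -natr1; lra.
apply: (@le_trans _ _ (P (stuck z z./2 m t `|` stuck z./2 0 (m + t) M))).
  apply: le_measure; rewrite ?inE; first exact: measurable_stuck.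
    by apply: measurableU; exact: measurable_stuck.
  (* If the first stage succeeds, the failure lies in the remaining ones, which start at time
     [m + t]. *)
  move=> w [hz h0]; have [hz2|] := boolP (sparse e z./2 (hist (m + t) w)); last by left.
  by right; split=> //; rewrite -addnA.
apply: (le_trans (measureU2 _ (measurable_stuck _ _ _ _) (measurable_stuck _ _ _ _))).
rewrite -natr1 mulrDl mul1r EFinD addeC; apply: leeD; [exact: tP|exact: MP].
Qed.

End Cover.
End Allocation.

(** * Number of stages, constants and the cover time *)

Lemma trunc_log2_ln_le {R : realType} (d : nat) : (2 <= d)%N ->
  (trunc_log 2 d).+1%:R <= 2 / ln 2 * ln d%:R :> R.
Proof.
move=> d2; have l2 : 0 < ln 2 :> R by rewrite ln_gt0 // ltr1n.
have le_ln (k : nat) : (0 < k <= d)%N -> ln k%:R <= ln d%:R :> R.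
  by move=> /andP[k0 kd]; rewrite ler_ln ?posrE ?ltr0n ?ler_nat //; apply: leq_trans kd.
have := le_ln (2 ^ trunc_log 2 d)%N; rewrite expn_gt0 trunc_logP ?(ltnW d2) //.
move=> /(_ isT).
rewrite natrX lnXn // -[_ *+ trunc_log 2 d]mulr_natl => h1.
(* As [d >= 2], [ln 2 <= ln d] pays for the successor, hence the factor 2. *)
have := le_ln 2%N; rewrite d2 => /(_ isT) h2.
rewrite mulrAC ler_pdivlMr // -natr1; lra.
Qed.

(** The infimum is at least [c] exactly when every [m] with all vertices covered is: a countable
    intersection of events on finite histories. *)
Lemma measurable_cover_time_ge {R : realType} {disp : measure_display}
    {T : measurableType disp} {P : probability T R} {V : finType} {e : rel V}
    {ball : nat -> T -> trajectory V} (c : \bar R) :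
  local_search_allocation P e ball ->
  measurable [set w | (c <= cover_time R ball w)%E].
Proof.
move=> alloc; rewrite (_ : [set w | _] = \bigcap_m
    [set w | (forall v, (1 <= loads_after ball m w v)%N) -> (c <= (m%:R)%:E)%E]).
  apply: bigcap_measurable => // m _.
  exact: (measurable_history alloc m
    [set h | (forall v, (1 <= load h v)%N) -> (c <= (m%:R)%:E)%E]).
apply/seteqP; split=> w /= cw.
  by move=> m _ covered; apply: (le_trans cw); apply: ereal_inf_lbound; exists m.
by apply/ereal_infP => _ [m covered <-]; exact: cw.
Qed.

Theorem theorem5p3 (R : realType) (alpha : R) (halpha : 1 < alpha) :
  exists2 C : R, 0 < C &
    forall (V : finType) (e : rel V) (n d : nat),
      symmetric e -> irreflexive e -> #|V| = n -> regular_graph e d -> (2 <= d)%N ->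
    forall (disp : measure_display) (T : measurableType disp)
           (P : probability T R) (ball : nat -> T -> trajectory V),
      local_search_allocation P e ball ->
      (P [set w | (C * (n%:R * (1 + ln n%:R * ln d%:R / d%:R)))%:E
                  <= cover_time R ball w]
       <= (n%:R `^ (- alpha))%:E)%E.
Proof.
have l2 : 0 < ln 2 :> R by rewrite ln_gt0 // ltr1n.
have l2_le1 : ln 2 <= 1 :> R by rewrite (le_trans (le_ln1Dx _)) // ltrNl; lra.
(* The 2 makes up for two factors [n]: the union bound over vertices and the [J <= n] stages. *)
set b : R := alpha + 2; have b0 : 0 <= b by rewrite /b; lra.
(* [K] is 2 from [2n/d], times [b], times [2 / ln 2] from the bound on [J]. *)
pose K : R := 4 * b / ln 2; have K0 : 0 <= K by rewrite divr_ge0 ?mulr_ge0 // ltW.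
(* Of the 6, 4 pays for [2n/d * 2d ln 2], 1 for rounding up in [J <= n] stages, and 1 makes [M_lt]
   strict. *)
exists (6 + K) => [|V e n d esym _ <- {n} ereg d2 disp T P ball alloc]; first by lra.
have d_gt0 : (0 < d)%N by exact: ltnW.
have n_gt0 := card_codomain_gt0 P (fun w => (ball 0 w).1).
have dn := regular_degree_le_card ereg n_gt0.
set n := #|V| in dn n_gt0 *; set J := (trunc_log 2 d).+1.
have nR : 0 < n%:R :> R by rewrite ltr0n.
have dR : 0 < d%:R :> R by rewrite ltr0n.
have J_le_n : (J <= n)%N.
  by apply: leq_trans dn; apply: leq_trans (trunc_logP (ltnSn 1) d_gt0); exact: ltn_expl.
have [M M_le MP] := covered_whp alloc esym ereg d_gt0 b b0 J d
  (trunc_log_ltn d (ltnSn 1)).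
rewrite -/n in M_le MP; set L : R := ln n%:R in M_le MP *.
have L0 : 0 <= L by rewrite ln_ge0 // ler1n.
have ld0 : 0 <= ln d%:R :> R by rewrite ln_ge0 // ler1n.
have M_lt : M%:R < (6 + K) * (n%:R * (1 + L * ln d%:R / d%:R)).
  have JR : J%:R <= n%:R :> R by rewrite ler_nat.
  have s0 : 0 <= n%:R * (L * ln d%:R / d%:R) by rewrite !mulr_ge0 // invr_ge0.
  have e1 : 2 * n%:R / d%:R * (2 * d%:R * ln 2) = 4 * n%:R * ln 2 :> R.
    by field; rewrite gt_eqF.
  have h1 : 4 * n%:R * ln 2 <= 4 * n%:R :> R by rewrite ler_piMr // mulr_ge0.
  have h2 : 2 * n%:R / d%:R * (J%:R * (b * L)) <= K * (n%:R * (L * ln d%:R / d%:R)).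
    have -> : K * (n%:R * (L * ln d%:R / d%:R)) =
        2 * n%:R / d%:R * (2 / ln 2 * ln d%:R * (b * L)).
      by rewrite /K; field; rewrite !gt_eqF.
    rewrite ler_wpM2l ?divr_ge0 ?mulr_ge0 // ler_wpM2r ?mulr_ge0 //.
    exact: trunc_log2_ln_le.
  have h3 : 0 <= K * n%:R by rewrite mulr_ge0.
  move: M_le; rewrite mulrDr e1 mulrDr mulr1 => M_le; lra.
apply: (@le_trans _ _ (P (stuck (e := e) (ball := ball) d 0 0 M))).
  apply: le_measure; rewrite ?inE.
  - exact: measurable_cover_time_ge alloc.
  - exact: (measurable_stuck alloc).
  (* At time 0 the bound [d] is trivial; bound 0 at time [M] would put the cover time strictly below
     the threshold. *)
  move=> w /= late; split; first exact: sparse_degree.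
  apply/negP => covered; move: late; apply/negP; rewrite -ltNge.
  apply: (@le_lt_trans _ _ (M%:R)%:E); last by rewrite lte_fin.
  apply: ereal_inf_lbound; exists M => // v.
  exact: (sparse0_covered esym ereg d_gt0).
apply: (le_trans (MP 0%N)); rewrite lee_fin /powR gt_eqF //.
have -> : - alpha * ln n%:R = ln n%:R + (ln n%:R - b * L) by rewrite /b /L; ring.
rewrite expRD expRD lnK ?posrE // ler_wpM2r ?ler_nat //.
Qed.
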